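(* Let $m\geq 2$ and $r\geq 3$ be integers. There exist a positive real $c'_{m,r}$ and a positive integer $n_2$ such that for all $n\geq n_2$, $$ex_L(n,C^r_{2m+1})\leq c'_{m,r}\, n^{1+\frac{1}{m}}.$$
   Context: An $r$-graph is an $r$-uniform hypergraph; it is linear if every two distinct edges share at most one vertex. $C^r_{k}$ ($k\geq3$) denotes the $r$-uniform linear cycle of length $k$: edges $e_1,\ldots,e_k$ with $|e_i\cap e_{i+1}|=1$ for $i\in[k-1]$, $|e_k\cap e_1|=1$, and $e_i\cap e_j=\emptyset$ for all other pairs $i\neq j$. $ex_L(n,F)$ is the maximum number of edges in a linear $r$-graph on $n$ vertices containing no copy of $F$ as a subgraph. *)

(* Defs.v *)
From mathcomp Require Import all_boot.
Set Implicit Arguments.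
Unset Strict Implicit.
Unset Printing Implicit Defensive.

(* A hypergraph on the vertex type V is its set of edges H : {set {set V}}. *)

Definition runiform (V : finType) (r : nat) (H : {set {set V}}) : bool :=
  [forall e in H, #|e| == r].

Definition linear_hgraph (V : finType) (H : {set {set V}}) : bool :=
  [forall e in H, forall f in H, (e != f) ==> (#|e :&: f| <= 1)].

(* The edge set C is a copy of the r-uniform linear cycle of length k, k >= 3.
   The edges are indexed by 'I_k, and ordS is the cyclic successor, so that
   |e_k :&: e_1| = 1 is the instance i = k - 1 of the first intersection
   condition. *)
Definition linear_cycle (r k : nat) (V : finType) (C : {set {set V}}) : bool :=
  [exists e : {ffun 'I_k -> {set V}},
    [&& injectiveb e,
        C == [set e i | i : 'I_k],
        [forall i, #|e i| == r],
        [forall i, #|e i :&: e (ordS i)| == 1]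
      & [forall i, forall j,
          [&& i != j, j != ordS i & i != ordS j] ==> (e i :&: e j == set0)]]].

(* F C says that C is a copy of the forbidden hypergraph. A forbidden hypergraph
   is thus given by the predicate of its copies, which is legitimate for a
   hypergraph without isolated vertices. *)
Definition contains_copy (F : forall V : finType, pred {set {set V}})
    (V : finType) (H : {set {set V}}) : bool :=
  [exists C : {set {set V}}, (C \subset H) && F V C].

Definition exL (r n : nat) (F : forall V : finType, pred {set {set V}}) : nat :=
  \max_(H : {set {set 'I_n}} |
        [&& runiform r H, linear_hgraph H & ~~ contains_copy F H]) #|H|.

(* Main.v *)
Require Import Defs.
From mathcomp Require Import all_boot all_order all_algebra.
From mathcomp Require Import reals exp.
From mathcomp Require Import zify.
Set Implicit Arguments.
Unset Strict Implicit.
Unset Printing Implicit Defensive.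

(** Pass to a subgraph of large minimum degree and split its vertices at random
    into zones 0, ..., m, so that every vertex keeps many edges into each zone,
    every such edge having one vertex labelled [true] and one labelled [false]
    there. Grow levels from a root, level t + 1 consisting of the [true] or of
    the [false] ends of the edges going from level t into zone t + 1. Since m
    expansions would exhaust the vertex set, at some level both sets of ends are
    small compared with the number of edges, and these edges form a dense
    bipartite graph between them.

    The chains climbing from the two ends of such an edge to the root first meet
    on a common level j, in a vertex q; by pigeonhole, (j, q) may be taken
    constant on a dense set of edges. A random 3-colouring makes the chains from
    the [true] ends, the chains from the [false] ends and the edges pairwise
    disjoint. A greedy path of odd length 2(m - j - 1) + 1 between the two kinds
    of ends then closes up, through two chains of length j + 1, to a linear cycle
    of length 2m + 1. *)

(** * Uniform and linear hypergraphs, minimum degree *)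

Lemma card_runiform (V : finType) (H : {set {set V}}) (r : nat) (e : {set V}) :
  runiform r H -> e \in H -> #|e| = r.
Proof. by move=> /forall_inP uniH /uniH/eqP. Qed.

Lemma sub_runiform (V : finType) (H E : {set {set V}}) (r : nat) :
  E \subset H -> runiform r H -> runiform r E.
Proof.
by move=> /subsetP EH /forall_inP uniH; apply/forall_inP => e /EH/uniH.
Qed.

Lemma sub_linear (V : finType) (H E : {set {set V}}) :
  E \subset H -> linear_hgraph H -> linear_hgraph E.
Proof.
move=> /subsetP EH /forall_inP linH; apply/forall_inP => e /EH/linH/forall_inP line.
by apply/forall_inP => f /EH/line.
Qed.

Lemma leq_card_bigcup (I V : finType) (A : I -> {set V}) :
  #|\bigcup_i A i| <= \sum_i #|A i|.
Proof.
elim/big_rec2: _ => [|i x y _ le]; first by rewrite cards0.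
by apply: leq_trans (leq_card_setU _ _) _; rewrite leq_add2l.
Qed.

Lemma linear_common2 (V : finType) (H : {set {set V}}) (e f : {set V}) (x y : V) :
  linear_hgraph H -> e \in H -> f \in H ->
  x \in e -> x \in f -> y \in e -> y \in f -> x != y -> e = f.
Proof.
move=> linH eH fH xe xf ye yf xy; apply/eqP/negPn/negP => nef.
have := forallP linH e; rewrite eH /= => /forallP /(_ f); rewrite fH nef /=.
apply/negP; rewrite -ltnNge; have <- : #|[set x; y]| = 2 by rewrite cards2 xy.
by apply/subset_leq_card/subsetP => z /set2P[]->; rewrite inE ?xe ?xf ?ye ?yf.
Qed.

(** A vertex of [X] of degree at most [d] is removed together with its edges. This costs at most [d]
    edges and one vertex of [X], so the density hypothesis survives and keeps the subgraph
    nonempty. *)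
Lemma min_degree_subgraph (V : finType) (E : {set {set V}}) (X : {set V}) (d : nat) :
  d * #|X| < #|E| ->
  exists E' : {set {set V}},
    [/\ E' \subset E, E' != set0
      & forall e v, e \in E' -> v \in e -> v \in X ->
          d < #|[set f in E' | v \in f]|].
Proof.
have [n] := ubnP #|X|; elim: n E X => // n IHn E X ltXn ltE.
have [|/forall_inPn[v vX]] :=
  boolP [forall v in X, d < #|[set f in E | v \in f]|].
  move=> /forall_inP degX; exists E; split=> // [|e v _ _ /degX//].
  by rewrite -card_gt0; apply: leq_ltn_trans ltE.
rewrite -leqNgt => degv.
have cX : #|X| = #|X :\ v|.+1 by rewrite (cardsD1 v X) vX.
have cE := cardsID [set f : {set V} | v \in f] E.
have eqI : E :&: [set f : {set V} | v \in f] = [set f in E | v \in f].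
  by apply/setP => f; rewrite !inE.
have [||E' [sE' nE' degE']] := IHn (E :\: [set f : {set V} | v \in f]) (X :\ v).
- by lia.
- rewrite -(ltn_add2l d) -mulnS -cX; apply: leq_trans ltE _.
  by rewrite -cE eqI leq_add2r.
exists E'; split=> // [|e u eE' ue uX]; first exact: subset_trans sE' (subsetDl _ _).
apply: degE' (eE') (ue) _; rewrite !inE uX andbT; apply/eqP => euv.
by have := subsetP sE' _ eE'; rewrite !inE -euv ue.
Qed.

(** * Uniformly random functions: independence and a Chernoff bound *)

(** Probabilities over a uniform [f] are kept as counts with denominators cleared; here the
    probability is [#|L| ^ - #|A|]. *)
Lemma card_ffun_agree (V L : finType) (g : V -> L) (A : {set V}) :
  #|[set f : {ffun V -> L} | [forall v in A, f v == g v]]| * #|L| ^ #|A|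
    = #|{ffun V -> L}|.
Proof.
pose F v := if v \in A then pred1 (g v) else predT.
have -> : #|[set f : {ffun V -> L} | [forall v in A, f v == g v]]| = #|family F|.
  apply: eq_card => f; rewrite inE; apply/forall_inP/familyP => fF v => [|vA].
    by rewrite /F; case: ifP => // /fF.
  by have := fF v; rewrite /F vA.
rewrite card_family card_ffun foldrE big_map -[LHS]/(_ * _) big_enum /=.
rewrite -(cardC A) expnD mulnC; congr (_ * _).
rewrite (bigID (mem A)) /= big1 ?mul1n => [|v vA]; last by rewrite /F vA card1.
rewrite -prod_nat_const; apply: eq_big => [v|v /negbTE vA]; first by [].
by rewrite /F vA; apply: eq_card.
Qed.

(** Independence of events on disjoint sets. Exchanging the values outside [A] of a pair [(f, h)] is
    an involution that turns [g1 f * g2 h] into [g1 f * g2 f]. *)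
Lemma sum_ffun_indep (V L : finType) (A : {set V}) (g1 g2 : {ffun V -> L} -> nat) :
  (forall f f' : {ffun V -> L}, {in A, f =1 f'} -> g1 f = g1 f') ->
  (forall f f' : {ffun V -> L}, (forall v, v \notin A -> f v = f' v) -> g2 f = g2 f') ->
  (\sum_f g1 f * g2 f) * #|{ffun V -> L}| = (\sum_f g1 f) * (\sum_f g2 f).
Proof.
move=> g1A g2A; pose mix (p : {ffun V -> L} * {ffun V -> L}) :=
  [ffun v => if v \in A then p.1 v else p.2 v].
pose swap (p : {ffun V -> L} * {ffun V -> L}) := (mix p, mix (p.2, p.1)).
have swapK : involutive swap.
  by case=> f h; rewrite /swap /mix /=; congr pair; apply/ffunP => v;
     rewrite !ffunE /=; case: (v \in A).
rewrite big_distrlr /= pair_big /= (reindex_inj (inv_inj swapK)) /=.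
rewrite -sum1_card big_distrlr /= pair_big /=; apply: eq_bigr => -[f h] _ /=.
rewrite muln1; congr (_ * _); [apply: g1A | apply: g2A] => v vA; rewrite ffunE /=.
  by rewrite vA.
by rewrite (negbTE vA).
Qed.

(** This is [(1 - 1/b)^b <= 1/2]: each of the first two binomial terms of [((b - 1) + 1)^b] is at
    least [(b - 1)^b]. *)
Lemma expn_chernoff_base (b : nat) : 0 < b -> 2 * b.-1 ^ b <= b ^ b.
Proof.
case: b => //= b _; rewrite -[X in _ <= X ^ _]addn1 expnDn.
rewrite big_ord_recl big_ord_recl /= subn0 bin0 bin1 /bump /= !exp1n !muln1 mul1n.
rewrite mul2n -addnn leq_add2l subSS subn0 expnS.
by apply: leq_trans (leq_addr _ _); rewrite leq_mul2r leqnSn orbT.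
Qed.

(* Exponential moment of the number X of matches: the product is 2 ^ (size s - X). *)
Lemma sum_prod_match (V L : finType) (k : nat) (s : seq {set V})
    (M : {set V} -> pred {ffun V -> L}) :
  (forall (A : {set V}) (f f' : {ffun V -> L}), {in A, f =1 f'} -> M A f = M A f') ->
  (forall A : {set V}, #|A| = k ->
     exists g : V -> L, forall f : {ffun V -> L}, {in A, f =1 g} -> M A f) ->
  all (fun A : {set V} => #|A| == k) s ->
  pairwise (fun A B : {set V} => [disjoint A & B]) s ->
  0 < #|L| ->
  (\sum_(f : {ffun V -> L}) \prod_(A <- s) (if M A f then 1 else 2))
      * (2 * #|L| ^ k) ^ size s
    <= #|{ffun V -> L}| * (2 * (2 * #|L| ^ k).-1) ^ size s.
Proof.
move=> Mloc Mex sk sd L0; set b := 2 * _.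
have O0 : 0 < #|{ffun V -> L}| by rewrite card_ffun expn_gt0 L0.
elim: s sk sd => [|A s IHs] /=.
  by rewrite !muln1 (eq_bigr (fun=> 1)) ?sum1_card // => f _; rewrite big_nil.
case/andP => /eqP Ak sk /andP[dA sd].
have := IHs sk sd; set G := (X in X * _ <= _) => leG.
have -> : \sum_(f : {ffun V -> L}) \prod_(B <- A :: s) (if M B f then 1 else 2) =
   \sum_(f : {ffun V -> L})
      (if M A f then 1 else 2) * \prod_(B <- s) (if M B f then 1 else 2).
  by apply: eq_bigr => f _; rewrite big_cons.
set G' := (X in X * _ <= _).
have GG : G' * #|{ffun V -> L}| = (\sum_(f : {ffun V -> L}) (if M A f then 1 else 2)) * G.
  apply: (@sum_ffun_indep _ _ A) => [f f' eqf|f f' eqf]; first by rewrite (Mloc _ _ _ eqf).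
  apply: eq_big_seq => B Bs; rewrite (Mloc _ f f') // => v vB; apply: eqf.
  by rewrite (disjointFl (allP dA _ Bs)).
(* A match has probability at least [2 / b], so the mean of this factor is at most
   [2 - 2 / b = 2 (b - 1) / b]. *)
have oneA : (\sum_(f : {ffun V -> L}) (if M A f then 1 else 2)) * b
    <= #|{ffun V -> L}| * (2 * b.-1).
  have [g gM] := Mex _ Ak.
  have : #|{ffun V -> L}| <= #|[set f | M A f]| * #|L| ^ k.
    rewrite -(card_ffun_agree g A) Ak leq_mul2r subset_leq_card ?orbT //.
    apply/subsetP => f; rewrite !inE => /forall_inP fg; apply: gM => v vA; exact/eqP/fg.
  have : (\sum_(f : {ffun V -> L}) (if M A f then 1 else 2)) + #|[set f | M A f]|
      = 2 * #|{ffun V -> L}|.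
    rewrite -sum1dep_card [X in _ + X = _]big_mkcond -big_split /= mulnC -sum_nat_const.
    by apply: eq_bigr => f _; case: (M A f).
  have : 0 < b by rewrite muln_gt0 expn_gt0 L0.
  rewrite /b; set S := \sum_(f : _) _; set Q := #|[set f | _]|; set O := #|{ffun V -> L}|.
  by set l := #|L| ^ k; nia.
rewrite -(leq_pmul2r O0) !expnS.
have := leq_mul oneA leG; rewrite [G' * _ * _]mulnAC GG; congr (_ <= _); lia.
Qed.

(** Markov's inequality for 2 to the number of failures bounds the probability by
    [2^D ((b - 1) / b)^(size s)] with [b = 2 #|L|^k]. As [size s = b (D + M0)], the power is at most
    [2^-(D + M0)]. *)
Lemma few_matches (V L : finType) (k D M0 : nat) (s : seq {set V})
    (M : {set V} -> pred {ffun V -> L}) :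
  (forall (A : {set V}) (f f' : {ffun V -> L}), {in A, f =1 f'} -> M A f = M A f') ->
  (forall A : {set V}, #|A| = k ->
     exists g : V -> L, forall f : {ffun V -> L}, {in A, f =1 g} -> M A f) ->
  all (fun A : {set V} => #|A| == k) s ->
  pairwise (fun A B : {set V} => [disjoint A & B]) s ->
  0 < #|L| ->
  size s = 2 * #|L| ^ k * (D + M0) ->
  #|[set f : {ffun V -> L} | count (M^~ f) s < D]| * 2 ^ M0 <= #|{ffun V -> L}|.
Proof.
move=> Mloc Mex sk sd L0.
have := sum_prod_match (k := k) Mloc Mex sk sd L0.
set b := 2 * _; set G := \sum_f _; move=> /= leG szs.
set bad := [set f | _].
have badG : #|bad| * 2 ^ size s <= 2 ^ D * G.
  rewrite -sum_nat_const big_distrr /= [X in _ <= X](bigID (mem bad)) /=.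
  apply: leq_trans (leq_addr _ _); apply: leq_sum => f; rewrite inE => /ltnW cD.
  have -> : \prod_(A <- s) (if M A f then 1 else 2) = 2 ^ (size s - count (M^~ f) s).
    elim: (s) => [|A s' IH]; first by rewrite big_nil.
    rewrite big_cons IH /=; have := count_size (M^~ f) s'.
    by case: (M A f) => ?; rewrite ?mul1n ?subSS // add0n subSn // expnS.
  by rewrite -expnD leq_exp2l //; lia.
have b1 : 0 < b.-1.
  have : 0 < #|L| ^ k by rewrite expn_gt0 L0.
  by rewrite /b; lia.
have bE1 : #|bad| * b ^ size s <= 2 ^ D * #|{ffun V -> L}| * b.-1 ^ size s.
  rewrite -(@leq_pmul2r (2 ^ size s)) ?expn_gt0 //.
  apply: leq_trans (_ : 2 ^ D * (G * b ^ size s) <= _).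
    by rewrite mulnAC mulnA leq_mul2r badG orbT.
  by rewrite -!mulnA leq_mul2l [b.-1 ^ _ * _]mulnC -expnMn leG orbT.
have bE2 : 2 ^ (D + M0) * b.-1 ^ size s <= b ^ size s.
  rewrite szs -/b !(expnM _ b) -expnMn.
  have [->//|DM0] := posnP (D + M0); rewrite leq_exp2r //.
  by apply: expn_chernoff_base; lia.
rewrite -(@leq_pmul2r (2 ^ D * b.-1 ^ size s)) ?muln_gt0 ?expn_gt0 ?b1 //.
have -> : #|bad| * 2 ^ M0 * (2 ^ D * b.-1 ^ size s) 
    = #|bad| * (2 ^ (D + M0) * b.-1 ^ size s).
  by rewrite expnD; lia.
apply: leq_trans (leq_mul (leqnn _) bE2) _; apply: leq_trans bE1 _.
by rewrite mulnAC mulnC mulnA.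
Qed.

(** * Random zones and labels *)

(** Meant for an edge minus the vertex it leaves from. Labelling all other vertices [None] lets each
    Boolean single out one end of the edge. *)
Definition in_zone (V : finType) (m : nat) (i : 'I_m.+1) (A : {set V})
    (f : {ffun V -> 'I_m.+1 * option bool}) : bool :=
  [exists w in A, exists z in A,
    [&& f w == (i, Some true), f z == (i, Some false)
      & [forall y in A, [|| y == w, y == z | f y == (i, None)]]]].

Lemma in_zone_local (V : finType) (m : nat) (i : 'I_m.+1) (A : {set V})
    (f f' : {ffun V -> 'I_m.+1 * option bool}) :
  {in A, f =1 f'} -> in_zone i A f = in_zone i A f'.
Proof.
move=> eqf; apply: eq_existsb => w; case: (boolP (w \in A)) => //= wA.
apply: eq_existsb => z; case: (boolP (z \in A)) => //= zA.
rewrite !eqf //; congr [&& _, _ & _]; apply: eq_forallb => y.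
by case: (boolP (y \in A)) => //= yA; rewrite eqf.
Qed.

Lemma in_zone_possible (V : finType) (m : nat) (i : 'I_m.+1) (A : {set V}) :
  1 < #|A| ->
  exists g : V -> 'I_m.+1 * option bool,
    forall f : {ffun V -> 'I_m.+1 * option bool},
      {in A, f =1 g} -> in_zone i A f.
Proof.
move=> /card_gt1P[w [z [wA zA wz]]].
exists (fun y => (i, if y == w then Some true else if y == z then Some false else None)).
move=> f fg; apply/exists_inP; exists w => //; apply/exists_inP; exists z => //.
rewrite !fg //= !eqxx [z == w]eq_sym (negbTE wz) !eqxx /=; apply/forall_inP => y yA.
by rewrite fg //=; case: eqP => //= _; case: (y =P z) => //= _; rewrite eqxx.
Qed.

(** By linearity the edges at [v] are disjoint outside [v], so [few_matches] applies to them. Each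
    pair of a vertex and a zone fails with probability at most [2^-M0], and a union bound over the
    [#|V| * m.+1] pairs concludes. *)
Lemma exists_zoning (V : finType) (H : {set {set V}}) (r m D M0 : nat) :
  2 < r -> linear_hgraph H -> runiform r H ->
  #|V| * m.+1 < 2 ^ M0 ->
  (forall e v, e \in H -> v \in e ->
     2 * (3 * m.+1) ^ r.-1 * (D + M0) <= #|[set f in H | v \in f]|) ->
  exists f : {ffun V -> 'I_m.+1 * option bool},
    forall e v (i : 'I_m.+1), e \in H -> v \in e ->
      D <= #|[set e in H | (v \in e) && in_zone i (e :\ v) f]|.
Proof.
move=> r2 linH uniH cM degH.
set L := ('I_m.+1 * option bool)%type.
have cL : #|{: L}| = 3 * m.+1 by rewrite card_prod card_option card_bool card_ord mulnC.
have L0 : 0 < #|{: L}| by rewrite cL.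
set bad := fun p : V * 'I_m.+1 => [set f : {ffun V -> L} | (p.1 \in cover H) &&
  (#|[set e in H | (p.1 \in e) && in_zone p.2 (e :\ p.1) f]| < D)].
have badle p : #|bad p| * 2 ^ M0 <= #|{ffun V -> L}|.
  case: p => v i; rewrite /bad /=.
  case: (boolP (v \in cover H)) => [/bigcupP[e0 e0H ve0]|]; last first.
    move=> _ /=; apply: leq_trans (_ : 0 <= _) => //.
    rewrite leqn0 muln_eq0 cards_eq0; apply/orP; left.
    by apply/eqP/setP => f; rewrite !inE.
  have := degH _ _ e0H ve0; set N := 2 * _ * _; set St := [set f in H | v \in f] => leN.
  (* Only [N] of the edges are kept, since [few_matches] prescribes the exact length; further edges
     can only help. *)
  pose s := [seq e :\ v | e <- take N (enum St)].
  have szs : size s = N by rewrite size_map size_take -cardE; case: ltngtP leN.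
  have takeP e : e \in take N (enum St) -> (e \in H) && (v \in e).
    by move/mem_take; rewrite mem_enum inE.
  have sk : all (fun A : {set V} => #|A| == r.-1) s.
    apply/allP => _ /mapP[e /takeP/andP[eH ve] ->].
    by have := card_runiform uniH eH; rewrite (cardsD1 v) ve => <-.
  have sd : pairwise (fun A B : {set V} => [disjoint A & B]) s.
    rewrite pairwise_map.
    have : uniq (take N (enum St)) by rewrite take_uniq ?enum_uniq.
    rewrite uniq_pairwise; move: (takeP).
    move: (take _ _) => l lP; apply: (@sub_in_pairwise _ (mem l)); last exact/allP.
    move=> e f /lP/andP[eH ve] /lP/andP[fH vf] /= nef.
    rewrite -setI_eq0; apply/eqP/setP => y; rewrite !inE.
    apply/negP => /andP[/andP[yv ye] /andP[_ yf]].
    by move/eqP: nef; apply; apply: (linear_common2 linH eH fH ye yf ve vf yv).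
  apply: leq_trans (few_matches (k := r.-1) (D := D) (M0 := M0) (s := s)
     (M := fun A f => in_zone i A f) _ _ sk sd L0 _).
  - rewrite leq_mul2r; apply/orP; right; apply/subset_leq_card/subsetP => f.
    rewrite !inE /=; apply: leq_ltn_trans; rewrite count_map -size_filter.
    rewrite cardE; apply: uniq_leq_size; first by rewrite filter_uniq ?take_uniq ?enum_uniq.
    move=> e; rewrite mem_filter => /andP[ez /takeP/andP[eH ve]].
    by rewrite mem_enum inE eH ve.
  - by move=> A f f'; apply: in_zone_local.
  - by move=> A cA; apply: in_zone_possible; lia.
  - by rewrite szs /N cL.
have [f fbad] : exists f, f \notin \bigcup_p bad p.
  have : #|\bigcup_p bad p| < #|{ffun V -> L}|.
    rewrite -(@ltn_pmul2r (2 ^ M0)) ?expn_gt0 //.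
    apply: leq_ltn_trans (_ : (\sum_p #|bad p|) * 2 ^ M0 < _).
      by rewrite leq_mul2r leq_card_bigcup orbT.
    rewrite big_distrl /=; apply: leq_ltn_trans (leq_sum _ _) _.
      by move=> p _; apply: badle.
    rewrite sum_nat_const card_prod card_ord mulnC ltn_pmul2l //.
    by rewrite card_ffun expn_gt0 L0.
  move=> lt; apply/existsP; rewrite -negb_forall; apply/negP => /forallP all.
  by move: lt; rewrite ltnNge subset_leq_card //; apply/subsetP => f _; apply: all.
exists f => e v i eH ve; rewrite leqNgt; apply: contra fbad => ltD.
by apply/bigcupP; exists (v, i) => //; rewrite inE /= ltD andbT; apply/bigcupP; exists e.
Qed.

(** * Linear cycles and greedy paths *)

(** Indexing by [nat] with [i < j] leaves a single wrap-around pair [(0, k.-1)]. Distinctness of the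
    edges comes for free: equal edges would meet in [r > 1] vertices. *)
Lemma contains_linear_cycle (V : finType) (H : {set {set V}}) (r k : nat)
    (c : nat -> {set V}) :
  1 < r -> 2 < k -> runiform r H ->
  (forall i, i < k -> c i \in H) ->
  (forall i j, i < j -> j < k ->
     #|c i :&: c j| = (j == i.+1) || ((i == 0) && (j == k.-1)) :> nat) ->
  contains_copy (linear_cycle r k) H.
Proof.
move=> r1 k2 uniH cH cI.
have cr i : i < k -> #|c i| = r by move=> /cH; apply: card_runiform uniH.
apply/existsP; exists [set c (val i) | i : 'I_k]; apply/andP; split.
  apply/subsetP => y /imsetP[i _ ->]; exact: cH (ltn_ord i).
apply/existsP; exists [ffun i : 'I_k => c i]; apply/and5P; split.
- have lt_neq (i j : 'I_k) : i < j -> c i <> c j.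
    move=> ij eqc; have := cI i j ij (ltn_ord j).
    by rewrite eqc setIid cr //; case: (_ || _); lia.
  apply/injectiveP => i j; rewrite !ffunE => eqc; apply/val_inj.
  by case: (ltngtP i j) => // /lt_neq; rewrite eqc.
- by apply/eqP/eq_imset => i; rewrite ffunE.
- by apply/forallP => i; rewrite ffunE cr.
- apply/forallP => i; rewrite !ffunE /=; have ik := ltn_ord i.
  case: (ltngtP i.+1 k) => [ltk||eqk]; last 1 first.
  + have -> : i.+1 %% k = 0 by rewrite eqk modnn.
    by rewrite setIC cI; [apply/eqP; lia | lia |].
  + by rewrite modn_small // cI // eqxx.
  + by lia.
- apply/forallP => i; apply/forallP => j; apply/implyP => /and3P[].
  rewrite -!val_eqE /= !ffunE.
  have main (a b : 'I_k) : a < b -> val b != a.+1 %% k -> val a != b.+1 %% k ->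
      c a :&: c b == set0.
    move=> ab nb na; rewrite -cards_eq0 cI //.
    have bk := ltn_ord b; rewrite modn_small in nb; last by lia.
    suff nab : ~~ ((val a == 0) && (val b == k.-1)).
      by rewrite (negbTE nb) (negbTE nab).
    apply: contra na => /andP[/eqP-> /eqP->].
    by rewrite prednK ?modnn //; lia.
  case: (ltngtP i j) => // ij _ h1 h2; first exact: main.
  by rewrite setIC; apply: main.
Qed.

Lemma card_bigcup_le (V : finType) (P : nat -> {set V}) (j r : nat) :
  (forall k, k < j -> #|P k| = r) -> #|\bigcup_(k < j) P k| <= j * r.
Proof.
move=> Pr; apply: leq_trans (leq_card_bigcup _) _.
by rewrite -[j in j * r]card_ord -sum_nat_const; apply: leq_sum => k _; rewrite Pr.
Qed.

(* Every vertex already used blocks at most one of the edges at the current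
   endpoint, by linearity, so the path can be extended greedily. *)
Lemma alternating_path (V : finType) (E : {set {set V}}) (U : bool -> {set V})
    (r d l : nat) :
  linear_hgraph E -> runiform r E -> E != set0 ->
  [disjoint U true & U false] ->
  (forall e b, e \in E -> exists2 v, v \in U b & v \in e) ->
  (forall e b v, e \in E -> v \in U b -> v \in e -> d < #|[set f in E | v \in f]|) ->
  r * l <= d ->
  exists (f : nat -> {set V}) (u v : V),
    [/\ (u \in U true) && ((l == 0) ==> (u == v)), v \in U (~~ odd l),
        exists2 e, e \in E & v \in e,
        forall i, i < l ->
          [/\ f i \in E, (u \in f i) = (i == 0) & (v \in f i) = (i.+1 == l)]
      & forall i j, i < j -> j < l -> #|f i :&: f j| = (j == i.+1) :> nat].
Proof.
move=> linE uniE E0 disU exU degU; elim: l => [|l IHl] led.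
  have /set0Pn[e eE] := E0; have [v vU ve] := exU e true eE.
  by exists (fun=> e), v, v; split; rewrite ?eqxx ?vU //; exists e.
have {IHl}[|f [u [v [/andP[uU uv0] vU [e0 e0E ve0] fP fI]]]] := IHl.
  by apply: leq_trans led; rewrite leq_mul2l leqnSn orbT.
(* The endpoint [v] is left out, because the next edge has to pass through it. *)
pose X := (\bigcup_(i < l) f i) :\ v.
have cX : #|X| <= r * l.
  apply: leq_trans (subset_leq_card (subsetDl _ _)) _.
  rewrite mulnC; apply: card_bigcup_le => i il; have [fE _ _] := fP i il.
  exact: card_runiform uniE fE.
have [e [eE ve eX]] : exists e, [/\ e \in E, v \in e & [disjoint e & X]].
  have [/set0Pn[e]|Y0] := boolP (
      [set g in E | v \in g] :&: [set g in E | [disjoint g & X]] != set0).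
    by rewrite !inE => /andP[/andP[eE ve] /andP[_ eX]]; exists e.
  have : #|[set g in E | v \in g]| <= #|X|; last first.
    move=> /(leq_trans (degU _ _ _ e0E vU ve0)); rewrite ltnNge.
    by rewrite (leq_trans cX (leq_trans _ led)) // leq_mul2l leqnSn orbT.
  have hit g : g \in [set g in E | v \in g] -> exists2 x, x \in g & x \in X.
    move=> gS; have := gS; rewrite inE => /andP[gE _].
    have : ~~ [disjoint g & X].
      apply: contra Y0 => gX; apply/set0Pn; exists g.
      by rewrite inE gS inE gE gX.
    by case/pred0Pn => x /= /andP[xg xX]; exists x.
  pose h (g : {set V}) := odflt v [pick x in g :&: X].
  have hP g : g \in [set g in E | v \in g] -> (h g \in g) && (h g \in X).
    move=> /hit[x xg xX]; rewrite /h; case: pickP => [y|/(_ x)]; first by rewrite inE.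
    by rewrite inE xg xX.
  rewrite -(card_in_imset (f := h)) => [|g g' gS g'S eqh].
    by apply/subset_leq_card/subsetP => _ /imsetP[g /hP/andP[_ hX] ->].
  have /andP[hg hX] := hP _ gS; have /andP[hg' _] := hP _ g'S; rewrite -eqh in hg'.
  move: gS g'S; rewrite !inE => /andP[gE vg] /andP[g'E vg'].
  apply: (linear_common2 linE gE g'E hg hg' vg vg').
  by move: hX; rewrite /X in_setD1 => /andP[].
have [v' v'U v'e] := exU e (odd l) eE.
have vv' : v' != v.
  apply/eqP => eqv; move: vU v'U; rewrite eqv; case: (odd l) => /= h1 h2.
    by rewrite (disjointFr disU) in h1.
  by rewrite (disjointFr disU) in h2.
have efi i y : i < l -> y \in e -> y \in f i -> y = v.
  move=> il ye yf; apply/eqP/negPn/negP => yv.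
  have yX : y \in X by rewrite !inE yv; apply/bigcupP; exists (Ordinal il).
  by rewrite (disjointFr eX ye) in yX.
exists (fun i => if i == l then e else f i), u, v'; split=> //.
- by rewrite uU.
- by rewrite /= negbK.
- by exists e.
- move=> i; rewrite ltnS leq_eqVlt; case: eqP => [-> _|/= _ il].
    split; rewrite ?eqxx //; apply/idP/eqP => [ue|l0]; last first.
      by move: uv0; rewrite l0 => /eqP->.
    (* If the new edge returned to [u] with [l > 0], then [u = v] and the path would have one edge,
       whose endpoint [v] lies in [U false], whereas [u] lies in [U true]. *)
    apply/eqP; rewrite -leqn0 leqNgt; apply/negP => l0.
    have [_ uf _] := fP 0 l0; have uv := efi 0 u l0 ue uf.
    have [_ _ vf] := fP 0 l0; rewrite -uv uf /= in vf.
    move: vU; rewrite -uv -(eqP (esym vf)) /=.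
    by rewrite (disjointFr disU uU).
  have [fE uf vf] := fP i il; split => //.
  rewrite eqSS (ltn_eqF il); apply/negP => v'f.
  by move: vv'; rewrite (efi i v' il v'e v'f) eqxx.
- move=> i j ij; rewrite ltnS leq_eqVlt; case: (j =P l) ij => [-> il _|/= _ ij jl].
    rewrite (ltn_eqF (_ : i < l)) //; have [_ _ vfi] := fP i il.
    have -> : f i :&: e = if i.+1 == l then [set v] else set0.
      apply/setP => y; rewrite !inE; apply/andP/idP => [[yf ye]|].
        by have eqy := efi i y il ye yf; rewrite eqy -vfi -eqy yf inE eqy.
      by rewrite -vfi; case: ifP => vf; rewrite inE // => /eqP->.
    by rewrite [l == _]eq_sym; case: ifP; rewrite ?cards1 ?cards0.
  by rewrite (ltn_eqF (ltn_trans ij jl)) fI.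
Qed.

(** * Chains climbing to the root *)

(* A linear path of [T] edges climbing from the leaf [s 0] in zone [T] to the
   root [s T] in zone 0: [P k] joins [s k] to [s k.+1], and [s k] is the only
   vertex of [P k] that carries the label [c (T - k)] of its zone [T - k]. *)
Definition chain (V : finType) (H : {set {set V}}) (zn : V -> nat)
    (lb : V -> option bool) (c : nat -> bool) (T : nat)
    (s : nat -> V) (P : nat -> {set V}) : Prop :=
  (forall k, k <= T -> zn (s k) = T - k /\ lb (s k) = Some (c (T - k))) /\
  (forall k, k < T ->
    [/\ P k \in H, s k \in P k, s k.+1 \in P k
      & forall y, y \in P k ->
          y = s k.+1 \/ zn y = T - k /\ (lb y = Some (c (T - k)) -> y = s k)]).

Lemma chain_zone (V : finType) (H : {set {set V}}) zn lb c T s P k y :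
  @chain V H zn lb c T s P -> k < T -> y \in P k ->
  zn y = T - k \/ zn y = T - k.+1 /\ y = s k.+1.
Proof.
move=> [znP PP] kT yP; have [_ _ _ /(_ y yP)] := PP k kT.
case=> [->|[-> _]]; last by left.
by right; have [-> _] := znP k.+1 kT.
Qed.

Lemma chain_label (V : finType) (H : {set {set V}}) zn lb c T s P k y :
  @chain V H zn lb c T s P -> k < T -> y \in P k ->
  zn y = T - k -> lb y = Some (c (T - k)) -> y = s k.
Proof.
move=> [znP PP] kT yP zy ly; have [_ _ _ /(_ y yP)] := PP k kT.
case=> [ys|[_]]; last exact.
by move: zy; rewrite ys; have [-> _] := znP k.+1 kT; lia.
Qed.

(** Zones decide: [P k] lies in zone [T - k] except for [s k.+1], which is one zone lower. *)
Lemma chain_linear (V : finType) (H : {set {set V}}) zn lb c T s P i j :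
  @chain V H zn lb c T s P -> i < j -> j < T ->
  #|P i :&: P j| = (j == i.+1) :> nat.
Proof.
move=> chP ij jT; have iT := ltn_trans ij jT.
have zI y : y \in P i :&: P j -> j = i.+1 /\ y = s i.+1.
  rewrite inE => /andP[/(chain_zone chP iT) zi /(chain_zone chP jT) zj].
  by case: zi => [|[]]; case: zj => [|[]]; move=> *;
    first [exfalso; lia | split=> //; lia].
case: (j =P i.+1) => [ji|nji] /=.
  have -> : P i :&: P j = [set s i.+1]; last by rewrite cards1.
  apply/setP => y; rewrite inE; apply/idP/eqP => [|->]; first by move/zI => [].
  have [_ PP] := chP; have [_ _ sPi _] := PP i iT; have [_ sPj _ _] := PP j jT.
  by rewrite inE sPi /= -ji.
apply/eqP; rewrite cards_eq0; apply/eqP/setP => y; rewrite in_set0.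
by apply/negP => /zI[].
Qed.

Lemma chain_leaf (V : finType) (H : {set {set V}}) zn lb c T s P k :
  @chain V H zn lb c T s P -> k < T -> (s 0 \in P k) = (k == 0).
Proof.
move=> chP kT; have [znP PP] := chP; apply/idP/eqP => [/(chain_zone chP kT)|->].
  by have [-> _] := znP 0 (leq0n _); lia.
by have [] := PP 0 (leq_ltn_trans (leq0n _) kT).
Qed.

(* Where the chains of [u] and [v] meet for the first time on their way up,
   they do so on the same level: this fixes the parity of the closed cycle. *)
Lemma chain_no_cross (V : finType) (H : {set {set V}}) zn lb c1 c2 T su Pu sv Pv j k k' y :
  @chain V H zn lb c1 T su Pu -> @chain V H zn lb c2 T sv Pv ->
  (forall i, i < T -> c1 i = c2 i) ->
  j < T -> (forall i, i < j -> Pu i :&: Pv i = set0) ->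
  k < k' -> k' <= j -> y \in Pu k -> y \in Pv k' -> False.
Proof.
move=> chu chv c12 jT dis kk' k'j yu yv.
have kT : k < T by lia.
have k'T : k' < T by lia.
(* Zones leave only consecutive levels and [y = su k.+1]. Its label then forces [y = sv k.+1], which
   also lies in [Pv k], so the chains would already meet on level [k < j]. *)
have [k'E ys] : k' = k.+1 /\ y = su k.+1.
  by case: (chain_zone chu kT yu) => [|[]]; case: (chain_zone chv k'T yv) => [|[]]; move=> *;
    first [exfalso; lia | split=> //; lia].
subst k'; have [znu _] := chu; have [zy ly] := znu k.+1 kT; rewrite -ys in zy ly.
have ysv : y = sv k.+1 by apply: (chain_label chv) => //; rewrite -c12 //; lia.
have [_ PPv] := chv; have [_ _ sPk _] := PPv k kT; rewrite -ysv in sPk.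
by have /setP/(_ y) := dis k k'j; rewrite !inE yu sPk.
Qed.

(** A second common vertex on level [j] would make [Pu j] and [Pv j] equal. For [j = 0] this edge
    would share both leaves with [e], so be [e]; for [j > 0] the labels give [su j = sv j], a common
    vertex on level [j - 1]. *)
Lemma chain_meet_disjoint (V : finType) (H : {set {set V}}) zn lb c1 c2 t su Pu sv Pv
    (e : {set V}) j q :
  linear_hgraph H -> e \in H ->
  @chain V H zn lb c1 t.+1 su Pu -> @chain V H zn lb c2 t.+1 sv Pv ->
  (forall i, i <= t -> c1 i = c2 i) ->
  su 0 \in e -> sv 0 \in e -> su 0 != sv 0 -> e <> Pu 0 ->
  j <= t -> (forall i, i < j -> Pu i :&: Pv i = set0) ->
  q \in Pu j -> q \in Pv j ->
  (forall k, k < j -> q \notin Pu k) /\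
  (forall k k' y, k <= j -> k' <= j -> y \in Pu k -> y \in Pv k' -> y = q).
Proof.
move=> linH eH chu chv c12 ue ve uv nePu jt dis qu qv; split=> [k kj|k k' y kj k'j yu yv].
  by apply/negP => qk; exact: (chain_no_cross chu chv c12 jt dis kj (leqnn j) qk qv).
have [||kk'] := ltngtP k k'.
- by move=> kk'; case: (chain_no_cross chu chv c12 jt dis kk' k'j yu yv).
- move=> kk'; case: (@chain_no_cross V H zn lb c2 c1 t.+1 sv Pv su Pu j k' k y) => //.
    by move=> i it; rewrite c12.
  by move=> i ij; rewrite setIC dis.
subst k'; move: kj; rewrite leq_eqVlt => /orP[/eqP kj|kj]; last first.
  by have /setP/(_ y) := dis k kj; rewrite !inE yu yv.
subst k; apply/eqP/negPn/negP => yq.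
have [znu PPu] := chu; have [znv PPv] := chv.
have [Puj suj _ _] := PPu j jt; have [Pvj svj _ _] := PPv j jt.
have PE := linear_common2 linH Puj Pvj yu yv qu qv yq.
case: j jt dis qu qv yu yv {k'j} Puj suj Pvj svj PE
  => [|j] jt dis qu qv yu yv Puj suj Pvj svj PE.
  apply: nePu; apply: (linear_common2 linH eH Puj ue suj ve _ uv); by rewrite PE.
have [zs ls] := znu j.+1 (ltnW jt).
have sE : su j.+1 = sv j.+1.
  by apply: (chain_label (k := j.+1) chv); [| rewrite -PE | | rewrite -c12 // subSS leq_subr].
have [_ _ h1 _] := PPu j (ltnW jt); have [_ _ h2 _] := PPv j (ltnW jt).
by have /setP/(_ (su j.+1)) := dis j (ltnSn j); rewrite !inE h1 sE h2.
Qed.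

(** By zones, a common vertex outside [P 0] lies in zone [t] with label [c t], hence is [s 1], which
    is in [P 0] after all. Within [P 0] linearity leaves only the leaf. *)
Lemma chain_edge_meet (V : finType) (H : {set {set V}}) zn lb c t s P (e : {set V}) k y :
  linear_hgraph H -> e \in H -> @chain V H zn lb c t.+1 s P ->
  (forall y, y \in e -> zn y = t.+1 \/ zn y = t /\ lb y = Some (c t)) ->
  s 0 \in e -> e <> P 0 -> k <= t -> y \in e -> y \in P k -> y = s 0.
Proof.
move=> linH eH chP eP se neP kt ye yP.
have [znP PP] := chP; have [P0 sP0 s1P0 _] := PP 0 isT.
have at0 : y \in P 0 -> y = s 0.
  move=> yP0; apply/eqP/negPn/negP => ys; apply: neP.
  exact: (linear_common2 linH eH P0 ye yP0 se sP0 ys).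
case: k kt yP => [|k] kt yP; first exact: at0.
have zy := chain_zone (k := k.+1) chP kt yP; have [|[zyt ly]] := eP y ye; first by lia.
have k0 : k = 0 by lia.
subst k; apply: at0; rewrite (chain_label (k := 1) chP kt yP) //; first by lia.
by rewrite ly; congr (Some (c _)); lia.
Qed.

(** * Random colouring and gluing of paths *)

(** Averaging: prescribing at most [B] values makes [e] good with probability at least [#|L|^-B], so
    some [f] achieves this proportion of [E]. *)
Lemma exists_good_coloring (V L T : finType) (E : {set T})
    (good : {ffun V -> L} -> pred T) (B : nat) :
  0 < #|L| ->
  (forall e, e \in E -> exists (g : V -> L) (A : {set V}),
     #|A| <= B /\ forall f : {ffun V -> L}, {in A, f =1 g} -> good f e) ->
  exists f, #|E| <= #|[set e in E | good f e]| * #|L| ^ B.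
Proof.
move=> L0 exg; apply/existsP; apply: contraT; rewrite negb_exists => /forallP none.
have O0 : 0 < #|{ffun V -> L}| by rewrite card_ffun expn_gt0 L0.
have lt : \sum_(f : {ffun V -> L}) #|[set e in E | good f e]| * #|L| ^ B
          < \sum_(f : {ffun V -> L}) #|E|.
  have [f0 _] := card_gt0P O0.
  rewrite (bigD1 f0) //= [X in _ < X](bigD1 f0) //= -addSn.
  by apply: leq_add; [|apply: leq_sum => f _; apply: ltnW]; rewrite ltnNge.
move: lt; rewrite ltnNge => /negP[]; rewrite sum_nat_const mulnC -sum_nat_const.
have -> : \sum_(f : {ffun V -> L}) #|[set e in E | good f e]| * #|L| ^ B =
    \sum_(e in E) #|[set f | good f e]| * #|L| ^ B.
  rewrite -!big_distrl /=; congr (_ * _).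
  under eq_bigr do rewrite -sum1dep_card big_mkcondr.
  rewrite exchange_big /=; apply: eq_bigr => e _.
  by rewrite -big_mkcond sum1dep_card.
apply: leq_sum => e /exg[g [A [AB gA]]].
rewrite -(card_ffun_agree g A); apply: leq_mul; last by rewrite leq_pexp2l.
apply/subset_leq_card/subsetP => f; rewrite !inE => /forall_inP fg.
by apply: gA => v vA; apply/eqP/fg.
Qed.

Lemma cards_I_sub1 (V : finType) (A B : {set V}) (z : V) :
  (forall y, y \in A -> y \in B -> y = z) -> #|A :&: B| = (z \in A) && (z \in B).
Proof.
move=> zP; have -> : A :&: B = if (z \in A) && (z \in B) then [set z] else set0.
  apply/setP => y; rewrite inE; apply/andP/idP => [[yA yB]|].
    by have yz := zP y yA yB; subst z; rewrite yA yB inE.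
  by case: ifP; rewrite inE // => /andP[zA zB] /eqP->.
by case: ifP; rewrite ?cards1 ?cards0.
Qed.

(** The colours separate the two chains and the path, except at the exempted vertices: the path
    meets the chains only in [u] and [v], and the chains meet only in [q]. *)
Lemma glue_chains (V : finType) (H : {set {set V}}) (r m j l : nat)
    (Pu Pv f : nat -> {set V}) (u v q : V) (col : V -> option bool) :
  1 < r -> runiform r H -> l + 2 * j.+1 = 2 * m + 1 -> 0 < l ->
  (forall i, i <= j -> Pu i \in H) -> (forall i, i <= j -> Pv i \in H) ->
  (forall i, i < l -> f i \in H) ->
  (forall a b, a < b -> b <= j -> #|Pu a :&: Pu b| = (b == a.+1)) ->
  (forall a b, a < b -> b <= j -> #|Pv a :&: Pv b| = (b == a.+1)) ->
  (forall a b, a < b -> b < l -> #|f a :&: f b| = (b == a.+1)) ->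
  (forall a, a <= j -> (u \in Pu a) = (a == 0)) ->
  (forall a, a <= j -> (v \in Pv a) = (a == 0)) ->
  (forall a, a <= j -> (q \in Pu a) = (a == j)) ->
  (forall a, a <= j -> (q \in Pv a) = (a == j)) ->
  (forall b, b < l -> (u \in f b) = (b == 0)) ->
  (forall b, b < l -> (v \in f b) = (b.+1 == l)) ->
  (forall a y, a <= j -> y \in Pu a -> y != u -> col y = Some true) ->
  (forall a y, a <= j -> y \in Pv a -> y != v -> y != q -> col y = Some false) ->
  (forall b y, b < l -> y \in f b -> col y = None) ->
  u != v -> u != q -> v != q ->
  contains_copy (linear_cycle r (2 * m + 1)) H.
Proof.
move=> r1 uniH lj l0 PuH PvH fH uu vv ff uPu vPv qPu qPv uf vf colA colB colC uv uq vq.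
have colu : col u = None by apply: (colC 0); rewrite ?uf.
have colv : col v = None.
  by apply: (colC l.-1); rewrite ?vf ?prednK //; lia.
have colq : col q = Some true by apply: (colA j); rewrite ?qPu // eq_sym.
have cuf a b : a <= j -> b < l -> #|Pu a :&: f b| = (a == 0) && (b == 0).
  move=> aj bl; rewrite -(uPu a) // -(uf b) //; apply: cards_I_sub1 => y yP yf.
  by apply/eqP/negPn/negP => yu; have := colA a y aj yP yu; rewrite (colC b).
have cuv a b : a <= j -> b <= j -> #|Pu a :&: Pv b| = (a == j) && (b == j).
  move=> aj bj; rewrite -(qPu a) // -(qPv b) //; apply: cards_I_sub1 => y yP yQ.
  apply/eqP/negPn/negP => yq.
  have yv : y != v.
    apply/eqP => yv; have := colA a y aj yP; rewrite yv colv => h.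
    by have := h _; rewrite eq_sym uv => /(_ isT).
  have := colB b y bj yQ yv yq; have [->|yu] := eqVneq y u; first by rewrite colu.
  by rewrite (colA a).
have cfv b a : b < l -> a <= j -> #|f b :&: Pv a| = (b.+1 == l) && (a == 0).
  move=> bl aj; rewrite -(vf b) // -(vPv a) //; apply: cards_I_sub1 => y yf yP.
  apply/eqP/negPn/negP => yv; have := colC b y bl yf.
  have [->|yq] := eqVneq y q; first by rewrite colq.
  by rewrite (colB a).
(* The cycle starts at [q], descends the chain of [u], follows the path to [v] and climbs back to
   [q]; the wrap-around pair is [Pu j] and [Pv j]. *)
pose c i := if i <= j then Pu (j - i) else
            if i <= j + l then f (i - j.+1) else Pv (i - (j + l).+1).
apply: (@contains_linear_cycle _ _ _ _ c) => //; first by lia.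
  move=> i ik; rewrite /c; case: leqP => h1; first by apply: PuH; lia.
  by case: leqP => h2; [apply: fH | apply: PvH]; lia.
clear - lj l0 uu vv ff cuf cuv cfv.
move=> a b ab bk; rewrite /c; case: (leqP a j) => aj; case: (leqP b j) => bj.
- by rewrite setIC uu; [congr nat_of_bool; lia | lia | lia].
- case: leqP => bl; first by rewrite cuf; [congr nat_of_bool; lia | lia | lia].
  by rewrite cuv; [congr nat_of_bool; lia | lia | lia].
- by lia.
- case: (leqP a (j + l)) => al; case: (leqP b (j + l)) => bl.
  + by rewrite ff; [congr nat_of_bool; lia | lia | lia].
  + by rewrite cfv; [congr nat_of_bool; lia | lia | lia].
  + by lia.
  + by rewrite vv; [congr nat_of_bool; lia | lia | lia].
Qed.

(** * Dense edges between leaves *)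

Definition meet_at (V : finType) (Pu Pv : nat -> {set V}) (j : nat) (q : V) : bool :=
  [&& q \in Pu j, q \in Pv j & [forall k : 'I_j, Pu k :&: Pv k == set0]].

Lemma exists_meet (V : finType) (Pu Pv : nat -> {set V}) (t : nat) (x : V) :
  x \in Pu t -> x \in Pv t -> exists2 j, j <= t & exists q, meet_at Pu Pv j q.
Proof.
move=> xu xv; have ex : exists k, Pu k :&: Pv k != set0.
  by exists t; apply/set0Pn; exists x; rewrite inE xu.
case: (ex_minnP ex) => j /set0Pn[q]; rewrite inE => /andP[qu qv] minj.
exists j; first by apply: minj; apply/set0Pn; exists x; rewrite inE xu.
exists q; apply/and3P; split=> //; apply/forallP => k.
by apply: contraT => /minj; rewrite leqNgt ltn_ord.
Qed.

(** Double counting: each [u] in [U] accounts for [r * t.+1] pairs [(j, q)] with [q \in P u j],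
    while every edge of [F] has at least one meeting pair. Counting only leaves whose chain passes
    through [q] keeps the density relative to the right vertex set. *)
Lemma popular_meet (V : finType) (F : {set {set V}}) (U : {set V}) (r t N : nat)
    (P : V -> nat -> {set V}) (w : bool -> {set V} -> V) :
  (forall u j, u \in U -> j <= t -> #|P u j| = r) ->
  (forall e, e \in F -> exists2 j, j <= t &
     exists q, meet_at (P (w true e)) (P (w false e)) j q) ->
  N * (r * t.+1) * #|U| < #|F| ->
  exists j q, j <= t /\
    N * #|[set u in U | q \in P u j]|
      < #|[set e in F | meet_at (P (w true e)) (P (w false e)) j q]|.
Proof.
move=> Pr Fm ltF.
pose Fjq j q := [set e in F | meet_at (P (w true e)) (P (w false e)) j q].
pose Ujq j q := [set u in U | q \in P u j].
suff /existsP[j /existsP[q ltjq]] :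
    [exists j : 'I_t.+1, exists q, N * #|Ujq j q| < #|Fjq j q|].
  by exists j, q; split; first exact: (ltn_ord j).
apply: contraT; rewrite negb_exists => /forallP none.
have le1 : #|F| <= \sum_(j < t.+1) \sum_q #|Fjq j q|.
  rewrite pair_big /=; apply: leq_trans (_ : #|\bigcup_(p : 'I_t.+1 * V) Fjq p.1 p.2| <= _).
    apply/subset_leq_card/subsetP => e eF; have [j jt [q mq]] := Fm e eF.
    by apply/bigcupP; exists (Ordinal (jt : j < t.+1), q) => //; rewrite inE eF.
  exact: leq_card_bigcup.
have le2 : \sum_(j < t.+1) \sum_q #|Fjq j q| <= \sum_(j < t.+1) \sum_q N * #|Ujq j q|.
  apply: leq_sum => j _; apply: leq_sum => q _; rewrite leqNgt.
  by have := none j; rewrite negb_exists => /forallP/(_ q).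
have eq3 (j : 'I_t.+1) : \sum_q N * #|Ujq j q| = N * r * #|U|.
  rewrite -big_distrr /= -mulnA; congr (_ * _).
  under eq_bigr do rewrite -sum1dep_card big_mkcondr.
  rewrite exchange_big /= mulnC -sum_nat_const; apply: eq_bigr => u uU.
  rewrite -(Pr u j) //; last by rewrite -ltnS ltn_ord.
  by rewrite -big_mkcond sum1_card.
move: le2; under [X in _ <= X]eq_bigr do rewrite eq3.
rewrite sum_nat_const card_ord => le2.
by move: (leq_trans ltF (leq_trans le1 le2)); rewrite mulnC -mulnA mulnCA ltnNge; lia.
Qed.

Lemma dense_leaves_cycle (V : finType) (H F : {set {set V}}) (r m t : nat)
    (zn : V -> nat) (lb : V -> option bool) (c : nat -> bool)
    (U : bool -> {set V}) (s : V -> nat -> V) (P : V -> nat -> {set V})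
    (w : bool -> {set V} -> V) (x : V) :
  2 < r -> linear_hgraph H -> runiform r H -> t < m ->
  (forall b u, u \in U b ->
     [/\ chain H zn lb (fun i => if i == t.+1 then b else c i) t.+1 (s u) (P u),
         s u 0 = u & s u t.+1 = x]) ->
  F \subset H ->
  (forall e y, e \in F -> y \in e -> zn y = t.+1 \/ zn y = t /\ lb y = Some (c t)) ->
  (forall e b, e \in F -> w b e \in U b /\ w b e \in e) ->
  (forall e b u, e \in F -> u \in U b -> u \in e -> u = w b e) ->
  (forall e b u, e \in F -> u \in U b -> e <> P u 0) ->
  3 ^ (r * (2 * m + 1)) * (r * (2 * m + 1)) * (r * m) * #|U true :|: U false| < #|F| ->
  contains_copy (linear_cycle r (2 * m + 1)) H.
Proof.
move=> r2 linH uniH tm chU FH Fz wU wuniq FP0 ltF.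
(* [B] bounds both the vertices to be coloured for one edge (the edge and two chains of at most [m]
   edges each) and the degree needed for the greedy path. The factor [3 ^ B] pays for the colouring
   and [r * m] for the choice of [(j, q)]. *)
set B := r * (2 * m + 1) in ltF.
have HF e : e \in F -> e \in H by apply: (subsetP FH).
have Hr e : e \in H -> #|e| = r by apply: card_runiform uniH.
have PH b u j : u \in U b -> j <= t -> P u j \in H.
  by move=> /chU[[_ PP] _ _] jt; have [] := PP j jt.
have disU : [disjoint U true & U false].
  rewrite -setI_eq0; apply/eqP/setP => u; rewrite !inE.
  apply/negP => /andP[/chU[[h1 _] s0 _] /chU[[h2 _] _ _]].
  have [_ l1] := h1 0 isT; have [_ l2] := h2 0 isT.
  by move: l2; rewrite l1 !subn0 eqxx.
have wdiff e : e \in F -> w true e != w false e.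
  move=> eF; have [h1 _] := wU e true eF; have [h2 _] := wU e false eF.
  by apply: contraTneq h1 => ->; rewrite (disjointFl disU h2).
have Pr u j : u \in U true :|: U false -> j <= t -> #|P u j| = r.
  by move=> /setUP[] uU jt; apply/Hr/(PH _ _ _ uU jt).
have Fm e : e \in F ->
    exists2 j, j <= t & exists q, meet_at (P (w true e)) (P (w false e)) j q.
  move=> eF; apply: (@exists_meet _ _ _ _ x).
    by have [/chU[[_ PP] _ <-] _] := wU e true eF; have [] := PP t (ltnSn t).
  by have [/chU[[_ PP] _ <-] _] := wU e false eF; have [] := PP t (ltnSn t).
have [|j [q [jt]]] := @popular_meet _ F (U true :|: U false) r t (3 ^ B * B) P w Pr Fm.
  apply: leq_ltn_trans ltF; rewrite leq_mul2r; apply/orP; right.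
  by rewrite leq_mul2l; apply/orP; right; rewrite leq_mul2l tm orbT.
set Ujq := [set u in _ | _]; set Fjq := [set e in F | _] => ltjq.
have meetP e : e \in Fjq ->
  [/\ e \in F, q \in P (w true e) j, q \in P (w false e) j
    & forall i, i < j -> P (w true e) i :&: P (w false e) i = set0].
  rewrite inE => /andP[eF /and3P[q1 q2 /forallP dis]]; split=> // i ij.
  exact/eqP/(dis (Ordinal ij)).
have sepP e : e \in Fjq ->
  [/\ forall k, k < j -> q \notin P (w true e) k,
      forall k, k < j -> q \notin P (w false e) k
    & forall k k' y, k <= j -> k' <= j ->
        y \in P (w true e) k -> y \in P (w false e) k' -> y = q].
  move=> /meetP[eF q1 q2 dis].
  have [ut ute] := wU e true eF; have [uf ufe] := wU e false eF.
  have [cht st _] := chU _ _ ut; have [chf sf _] := chU _ _ uf.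
  have e1 : s (w true e) 0 \in e by rewrite st.
  have e2 : s (w false e) 0 \in e by rewrite sf.
  have e12 : s (w true e) 0 != s (w false e) 0 by rewrite st sf wdiff.
  have e21 : s (w false e) 0 != s (w true e) 0 by rewrite eq_sym.
  have c12 b b' i : i <= t ->
      (if i == t.+1 then b else c i) = (if i == t.+1 then b' else c i).
    by move=> it; rewrite ltn_eqF.
  have dis' i : i < j -> P (w false e) i :&: P (w true e) i = set0.
    by move=> ij; rewrite setIC dis.
  have [h1 h2] := chain_meet_disjoint linH (HF _ eF) cht chf (c12 _ _) e1 e2 e12
    (FP0 _ _ _ eF ut) jt dis q1 q2.
  by have [h3 _] := chain_meet_disjoint linH (HF _ eF) chf cht (c12 _ _) e2 e1 e21
    (FP0 _ _ _ eF uf) jt dis' q2 q1.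
have edgeP e b k y : e \in Fjq -> k <= t -> y \in e -> y \in P (w b e) k -> y = w b e.
  move=> /meetP[eF _ _ _] kt ye yP.
  have [ub ube] := wU e b eF; have [chb sb _] := chU _ _ ub.
  rewrite -sb; apply: (chain_edge_meet linH (HF _ eF) chb _ _ _ kt ye yP); rewrite ?sb //.
    by move=> z ze; rewrite ltn_eqF //; apply: Fz eF ze.
  exact: FP0 eF ub.
pose good (col : {ffun V -> option bool}) (e : {set V}) :=
  [&& [forall y in e, col y == None],
      [forall k : 'I_j.+1, forall y in P (w true e) k,
         (y != w true e) ==> (col y == Some true)]
    & [forall k : 'I_j.+1, forall y in P (w false e) k,
         (y != w false e) && (y != q) ==> (col y == Some false)]].
have [||col leF] := @exists_good_coloring V (option bool) _ Fjq good B.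
- by rewrite card_option card_bool.
- move=> e eFjq; have [eF q1 q2 dis] := meetP e eFjq; have [_ _ sep] := sepP e eFjq.
  pose X b := \bigcup_(k < j.+1) P (w b e) k.
  (* The requirements are compatible: the edge meets each chain only in its leaf, the chains meet
     only in [q], and these vertices are exempted where needed. *)
  exists (fun y => if y \in e then None else if y \in X true then Some true else Some false).
  exists (e :|: X true :|: X false); split.
    have cX b : #|X b| <= j.+1 * r.
      apply: card_bigcup_le => k kj; apply: Pr; last exact: leq_trans (kj : k <= j) jt.
      by have [ub _] := wU e b eF; rewrite inE; case: (b) ub => ->; rewrite ?orbT.
    apply: leq_trans (leq_card_setU _ _) _.
    apply: leq_trans (leq_add (leq_card_setU _ _) (leqnn _)) _.
    apply: leq_trans (leq_add (leq_add (leqnn _) (cX true)) (cX false)) _.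
    rewrite Hr ?HF // /B; have : j.+1 <= m by exact: leq_trans tm.
    move: (j.+1) => k km; rewrite mulnDr muln1 mulnCA mul2n -addnn [r * m]mulnC.
    by have := leq_mul2r r k m; rewrite km orbT; clear; lia.
  move=> f fg; apply/and3P; split.
  + by apply/forall_inP => y ye; rewrite fg ?ye // !inE ye.
  + apply/forallP => k; apply/forall_inP => y yP; apply/implyP => yw.
    have yX : y \in X true by apply/bigcupP; exists k.
    rewrite fg; last by rewrite !inE yX orbT.
    case: ifP => [ye|_]; last by rewrite yX.
    by rewrite (edgeP e true k y eFjq (leq_trans (ltn_ord k : k <= j) jt) ye yP) eqxx in yw.
  + apply/forallP => k; apply/forall_inP => y yP; apply/implyP => /andP[yw yq].
    have yX : y \in X false by apply/bigcupP; exists k.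
    rewrite fg; last by rewrite !inE yX orbT.
    case: ifP => [ye|_].
      by rewrite (edgeP e false k y eFjq (leq_trans (ltn_ord k : k <= j) jt) ye yP) eqxx in yw.
    case: ifP => // /bigcupP[k' _ yP'].
    by rewrite (sep k' k y (ltn_ord k') (ltn_ord k) yP' yP) eqxx in yq.
set Fg := [set e in Fjq | good col e] in leF.
have ltg : B * #|Ujq| < #|Fg|.
  rewrite -(@ltn_pmul2r (3 ^ B)) ?expn_gt0 //; apply: leq_trans (_ : #|Fjq| <= _).
    by rewrite mulnC mulnA.
  by apply: leq_trans leF _; rewrite card_option card_bool.
have [E [EFg E0 degE]] := min_degree_subgraph ltg.
have EP e : e \in E -> e \in Fjq /\ good col e.
  by move=> /(subsetP EFg); rewrite inE => /andP.
have EF e : e \in E -> e \in F by move=> /EP[/meetP[]].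
(* An odd length makes the path end in [U false], and [l + 2 * j.+1 = 2 * m + 1]. *)
pose l := (2 * (m - j.+1)).+1.
have jm : j < m by apply: leq_ltn_trans jt tm.
have EH : E \subset H by apply/subsetP => e /EF/HF.
have linE := sub_linear EH linH; have uniE := sub_runiform EH uniH.
have wUjq e b : e \in E -> w b e \in U b :&: Ujq.
  move=> eE; have [/meetP[eF q1 q2 _] _] := EP e eE; have [ub _] := wU e b eF.
  by rewrite !inE ub /=; case: b ub => ->; rewrite ?orbT ?q1 ?q2.
have [||||f [u [v [/andP[uU _] vU _ fP fI]]]] :=
  @alternating_path V E (fun b => U b :&: Ujq) r B l linE uniE E0.
- apply: disjointW disU; exact: subsetIl.
- move=> e b eE; exists (w b e); first exact: wUjq.
  by have [] := wU e b (EF _ eE).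
- by move=> e b v eE; rewrite inE => /andP[_ vU] ve; apply: degE eE ve vU.
- by rewrite leq_mul2l /l; apply/orP; right; clear - jm; lia.
have {vU}vU : v \in U false by move: vU; rewrite /l /= mul2n odd_double inE => /andP[].
have {uU}uU : u \in U true by move: uU; rewrite inE => /andP[].
have [f0E uf0 _] := fP 0 isT; have [flE _ vfl] := fP l.-1 (ltnSn _).
(* The chains of [u] and [v] belong to different edges of [F], so [sepP] does not separate them;
   their disjointness away from [q] comes from the common colouring [col]. *)
have uw : u = w true (f 0) by apply: wuniq (EF _ f0E) uU _; rewrite uf0.
have vw : v = w false (f l.-1) by apply: wuniq (EF _ flE) vU _; rewrite vfl.
have [f0Fjq /and3P[_ /forallP gA _]] := EP _ f0E.
have [flFjq /and3P[_ _ /forallP gB]] := EP _ flE.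
have [_ qu _ _] := meetP _ f0Fjq; have [qu' _ _] := sepP _ f0Fjq.
have [_ _ qv _] := meetP _ flFjq; have [_ qv' _] := sepP _ flFjq.
rewrite -uw in gA qu qu'; rewrite -vw in gB qv qv'.
have [chu su _] := chU _ _ uU; have [chv sv _] := chU _ _ vU.
have colC b y : b < l -> y \in f b -> col y = None.
  move=> bl yf; have [/EP[_ /and3P[/forall_inP h _ _]] _ _] := fP b bl; exact/eqP/h.
have colA a y : a <= j -> y \in P u a -> y != u -> col y = Some true.
  move=> aj yP yu; have /forall_inP/(_ y yP) := gA (Ordinal (aj : a < j.+1)).
  by rewrite yu => /eqP.
have colB a y : a <= j -> y \in P v a -> y != v -> y != q -> col y = Some false.
  move=> aj yP yv yq; have /forall_inP/(_ y yP) := gB (Ordinal (aj : a < j.+1)).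
  by rewrite yv yq => /eqP.
have ltj a : a <= j -> a < t.+1 by move=> aj; apply: leq_trans jt.
(* A leaf equal to [q] would put [q] in [e] and on both chains, hence equal to both ends of [e]. *)
have qf b e : e \in E -> q != w b e.
  move=> eE; have [eFjq _] := EP e eE; apply/eqP => qw.
  have [eF q1 q2 _] := meetP e eFjq.
  have qe : q \in e by rewrite qw; have [] := wU e b eF.
  have := wdiff e eF; rewrite -(edgeP e true j q eFjq jt qe q1).
  by rewrite -(edgeP e false j q eFjq jt qe q2) eqxx.
apply: (@glue_chains V H r m j l (P u) (P v) f u v q col) => //.
- exact: ltnW.
- by rewrite /l; clear - jm; lia.
- by move=> i /ltj; apply: PH uU.
- by move=> i /ltj; apply: PH vU.
- by move=> i /fP[/EF/HF].
- by move=> a b ab /ltj; apply: chain_linear chu ab.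
- by move=> a b ab /ltj; apply: chain_linear chv ab.
- by move=> a /ltj at'; rewrite -{1}su (chain_leaf chu at').
- by move=> a /ltj at'; rewrite -{1}sv (chain_leaf chv at').
- move=> a; rewrite leq_eqVlt => /orP[/eqP->|aj]; first by rewrite qu eqxx.
  by rewrite (negbTE (qu' a aj)) ltn_eqF.
- move=> a; rewrite leq_eqVlt => /orP[/eqP->|aj]; first by rewrite qv eqxx.
  by rewrite (negbTE (qv' a aj)) ltn_eqF.
- by move=> b /fP[].
- by move=> b /fP[].
- by apply: contraTneq uU => ->; rewrite (disjointFl disU vU).
- by rewrite eq_sym uw qf.
- by rewrite eq_sym vw qf.
Qed.

(** * Growing the levels *)

Lemma in_zoneP (V : finType) (m : nat) (i : 'I_m.+1) (A : {set V})
    (f : {ffun V -> 'I_m.+1 * option bool}) :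
  in_zone i A f ->
  [/\ forall y, y \in A -> (f y).1 = i,
      forall b, exists2 w, w \in A & f w = (i, Some b)
    & forall b y y', y \in A -> y' \in A ->
        f y = (i, Some b) -> f y' = (i, Some b) -> y = y'].
Proof.
case/exists_inP => w wA /exists_inP[z zA /and3P[/eqP fw /eqP fz /forall_inP fA]].
have fP y : y \in A -> [\/ y = w, y = z | f y = (i, None)].
  by move=> /fA/or3P[]/eqP; [constructor 1 | constructor 2 | constructor 3].
split=> [y /fP[->|->|->]|[]|b y y' /fP yP /fP y'P]; rewrite ?fw ?fz //.
- by exists w.
- by exists z.
- by case: yP => ->; case: y'P => ->; rewrite ?fw ?fz //; case: b.
Qed.

(** The edges leaving [S] number at least [D * #|S|]. Either one of the two sets of ends has at
    least a [1 / K] share of their number and becomes the next level, or the edges are dense between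
    the two sets and give the cycle. *)
Lemma next_level (V : finType) (H : {set {set V}}) (r m t D K : nat)
    (f : {ffun V -> 'I_m.+1 * option bool})
    (S : {set V}) (c : nat -> bool) (s : V -> nat -> V) (P : V -> nat -> {set V})
    (x : V) :
  2 < r -> linear_hgraph H -> runiform r H -> t < m ->
  K = 2 * (3 ^ (r * (2 * m + 1)) * (r * (2 * m + 1)) * (r * m)).+1 ->
  (forall v (i : 'I_m.+1), v \in cover H ->
      D <= #|[set e in H | (v \in e) && in_zone i (e :\ v) f]|) ->
  S \subset cover H ->
  (forall u, u \in S ->
    [/\ chain H (fun v => (f v).1) (fun v => (f v).2) c t (s u) (P u),
        s u 0 = u & s u t = x]) ->
  contains_copy (linear_cycle r (2 * m + 1)) H \/
  exists (S' : {set V}) (c' : nat -> bool) (s' : V -> nat -> V)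
      (P' : V -> nat -> {set V}),
    [/\ S' \subset cover H, D * #|S| <= K * #|S'|
      & forall u, u \in S' ->
        [/\ chain H (fun v => (f v).1) (fun v => (f v).2) c' t.+1 (s' u) (P' u),
            s' u 0 = u & s' u t.+1 = x]].
Proof.
move=> r2 linH uniH tm KE degH SH chS.
pose i : 'I_m.+1 := Ordinal (tm : t.+1 < m.+1).
pose zn v : nat := (f v).1; pose lb v := (f v).2.
pose Ch v := [set e in H | (v \in e) && in_zone i (e :\ v) f].
pose E := \bigcup_(v in S) Ch v.
have zS v : v \in S -> zn v = t /\ lb v = Some (c t).
  by move=> /chS[[h _] s0 _]; have := h 0 isT; rewrite s0 subn0.
have ChP v e : v \in S -> e \in Ch v ->
  [/\ e \in H, v \in e, forall y, y \in e -> y = v \/ zn y = t.+1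
    & forall b, exists2 w, w \in e & f w = (i, Some b) /\
        forall y, y \in e -> f y = (i, Some b) -> y = w].
  move=> vS; rewrite inE => /and3P[eH ve /in_zoneP[z1 z2 z3]]; split=> // [y ye|b].
    have [->|yv] := eqVneq y v; [by left | right].
    by rewrite /zn z1 // !inE yv.
  have [w wA fw] := z2 b; exists w; first by move: wA; rewrite inE => /andP[].
  split=> // y ye fy; apply: (z3 b y w) => //; rewrite !inE ye andbT.
  apply/eqP => yv; have [+ _] := zS v vS; rewrite -yv /zn fy /= => /eqP.
  by rewrite gtn_eqF.
(* The sets [Ch v] are disjoint: [v] is the only vertex of such an edge in zone [t]. *)
have cE : D * #|S| <= #|E|.
  apply: leq_trans (_ : \sum_(v in S) #|Ch v| <= _).
    rewrite mulnC -sum_nat_const; apply: leq_sum => v vS; apply: degH.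
    exact: (subsetP SH).
  have -> : \sum_(v in S) #|Ch v| = \sum_(v in S) \sum_(e in E) (e \in Ch v).
    apply: eq_bigr => v vS; rewrite -sum1_card big_mkcond [RHS]big_mkcond /=.
    apply: eq_bigr => e _; case: (boolP (e \in Ch v)) => [eCh|_]; last by case: ifP.
    by case: ifP => // /bigcupP[]; exists v.
  rewrite exchange_big /= -sum1_card; apply: leq_sum => e eE.
  have [v vS eCh] := bigcupP eE; rewrite (bigD1 v) //= eCh big1 // => v' /andP[v'S v'v].
  apply/eqP; rewrite eqb0; apply/negP => eCh'.
  have [_ v'e _ _] := ChP _ _ v'S eCh'; have [_ _ ze _] := ChP _ _ vS eCh.
  have [zv' _] := zS _ v'S; case: (ze _ v'e) => [ev|]; first by rewrite ev eqxx in v'v.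
  by rewrite zv' => /eqP; rewrite ltn_eqF.
pose p e := odflt x [pick v in S | e \in Ch v].
have pP e : e \in E -> p e \in S /\ e \in Ch (p e).
  move=> /bigcupP[v vS eCh]; rewrite /p; case: pickP => [u /andP[] //|/(_ v)].
  by rewrite vS eCh.
pose w b e := odflt x [pick y in (e : {set V}) | f y == (i, Some b)].
have wP e b : e \in E -> [/\ w b e \in e, f (w b e) = (i, Some b)
    & forall y, y \in e -> f y = (i, Some b) -> y = w b e].
  move=> /pP[pS eCh]; have [_ _ _ /(_ b)[z ze [fz uz]]] := ChP _ _ pS eCh.
  rewrite /w; case: pickP => [y /andP[ye /eqP fy]|/(_ z)]; last by rewrite ze fz eqxx.
  by split=> // y' y'e fy'; rewrite (uz y') // (uz y).
pose U b := [set w b e | e in E].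
(* One edge [pe u] is chosen to carry [u] back to level [t]; it extends the chain of its lower
   vertex [p (pe u)]. *)
pose pe u := odflt set0 [pick e in E | u \in (e : {set V})].
have UP b u : u \in U b -> [/\ pe u \in E, u \in pe u & f u = (i, Some b)].
  move=> /imsetP[e eE ->]; have [we fw _] := wP e b eE; rewrite /pe.
  by case: pickP => [e' /andP[]//|/(_ e)]; rewrite eE we.
pose s' u k := if k is k'.+1 then s (p (pe u)) k' else u.
pose P' u k := if k is k'.+1 then P (p (pe u)) k' else pe u.
have ch' b u : u \in U b ->
  [/\ chain H zn lb (fun i => if i == t.+1 then b else c i) t.+1 (s' u) (P' u),
      s' u 0 = u & s' u t.+1 = x].
  move=> uU; have [peE upe fu] := UP b u uU; have [pS peCh] := pP _ peE.
  have [[h1 h2] sp0 spt] := chS _ pS; have [peH ppe zpe _] := ChP _ _ pS peCh.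
  have [_ _ uw] := wP _ b peE.
  split=> //; split=> [[|k]|[|k]] kt.
  - by rewrite /zn /lb /= fu /= eqxx.
  - have [z l] := h1 k kt; rewrite /s' subSS ltn_eqF ?ltnS ?leq_subr //.
  - split=> //=; first by rewrite sp0.
    move=> y ype; rewrite sp0; have [->|zy] := zpe y ype; [by left | right].
    split=> //; rewrite subn0 eqxx => ly; have fy : f y = (i, Some b).
      by rewrite [f y]surjective_pairing -/(lb y) ly; congr pair; apply: val_inj.
    exact: etrans (uw y ype fy) (esym (uw u upe fu)).
  - have [g1 g2 g3 g4] := h2 k kt; split=> //= y yP.
    have := g4 y yP; rewrite subSS; case=> [|[z l]]; [by left | right].
    by split=> //; rewrite ltn_eqF ?ltnS ?leq_subr.
have UH b : U b \subset cover H.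
  apply/subsetP => u /UP[/bigcupP[v vS peCh] upe _].
  by have [peH _ _ _] := ChP _ _ vS peCh; apply/bigcupP; exists (pe u).
have [leE|ltEt] := leqP #|E| (K * #|U true|).
  right; exists (U true), (fun i => if i == t.+1 then true else c i), s', P'.
  by split=> //; [apply: leq_trans cE leE | apply: ch'].
have [leE|ltEf] := leqP #|E| (K * #|U false|).
  right; exists (U false), (fun i => if i == t.+1 then false else c i), s', P'.
  by split=> //; [apply: leq_trans cE leE | apply: ch'].
(* Discarding the chosen edges keeps every edge of [F] distinct from the first edges of the chains,
   at a cost of at most one edge per leaf. This is the [.+1] in [K]; the factor 2 comes from adding
   the bounds for the two sets of ends. *)
left; pose F := E :\: [set pe u | u in U true :|: U false].
have FE e : e \in F -> e \in E by rewrite inE => /andP[].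
apply: (@dense_leaves_cycle V H F r m t zn lb c U s' P' w x) => //.
- apply/subsetP => e /FE/pP[pS eCh]; by have [] := ChP _ _ pS eCh.
- move=> e y /FE/pP[pS eCh] ye; have [_ _ ze _] := ChP _ _ pS eCh.
  by have [->|zy] := ze y ye; [right; apply: zS | left].
- move=> e b /FE eE; have [we _ _] := wP e b eE; split=> //; exact: imset_f.
- move=> e b u /FE eE /UP[_ _ fu] ue; have [_ _ uw] := wP e b eE; exact: uw.
- move=> e b u; rewrite inE => /andP[/imsetP ne _] uU eP; apply: ne.
  by exists u => //; rewrite inE; case: b uU => ->; rewrite ?orbT.
have cF : #|E| <= #|F| + #|U true :|: U false|.
  rewrite -(cardsID [set pe u | u in U true :|: U false] E) addnC leq_add2l.
  apply: leq_trans (subset_leq_card (subsetIr _ _)) _; exact: leq_imset_card.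
have cU : #|U true :|: U false| <= #|U true| + #|U false| by exact: leq_card_setU.
move: cF cU ltEt ltEf; rewrite {}KE; clear.
move: (3 ^ _ * _ * _) => N; move: #|E| #|F| #|U true| #|U false| #|_ :|: _| => a b c d e.
by nia.
Qed.

(** * From zones to the density condition *)

Definition expansion_const (r m : nat) : nat :=
  2 * (3 ^ (r * (2 * m + 1)) * (r * (2 * m + 1)) * (r * m)).+1.

(** Each level loses a factor [expansion_const r m] from the degree, so levels grow by a factor [a];
    level [m] would have at least [a ^ m > #|V|] vertices. *)
Lemma zoned_cycle (V : finType) (H : {set {set V}}) (r m a : nat)
    (f : {ffun V -> 'I_m.+1 * option bool}) :
  2 < r -> linear_hgraph H -> runiform r H -> H != set0 ->
  #|V| < a ^ m -> 0 < a ->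
  (forall v (i : 'I_m.+1), v \in cover H ->
      expansion_const r m * a <= #|[set e in H | (v \in e) && in_zone i (e :\ v) f]|) ->
  contains_copy (linear_cycle r (2 * m + 1)) H.
Proof.
move=> r2 linH uniH H0 Va a0 degH.
have K0 : 0 < expansion_const r m by [].
(* The root must itself satisfy the chain condition for [T = 0]; it is found as the [true] end of an
   edge going into zone 0. *)
have [x xH fx] : exists2 x, x \in cover H & f x = (ord0, Some true).
  have /set0Pn[e eH] := H0.
  have : 0 < #|e| by rewrite (card_runiform uniH eH) ltnW // ltnW.
  case/card_gt0P => v ve; have vH : v \in cover H by apply/bigcupP; exists e.
  have : 0 < #|[set e in H | (v \in e) && in_zone ord0 (e :\ v) f]|.
    by apply: leq_trans (degH v ord0 vH); rewrite muln_gt0 K0 a0.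
  case/card_gt0P => e'; rewrite inE => /and3P[e'H _ /in_zoneP[_ /(_ true)[x xe fx] _]].
  exists x => //; apply/bigcupP; exists e' => //; by move: xe; rewrite inE => /andP[].
have levels t : t <= m ->
  contains_copy (linear_cycle r (2 * m + 1)) H \/
  exists (S : {set V}) (c : nat -> bool) (s : V -> nat -> V) (P : V -> nat -> {set V}),
    [/\ S \subset cover H, a ^ t <= #|S|
      & forall u, u \in S ->
        [/\ chain H (fun v => (f v).1) (fun v => (f v).2) c t (s u) (P u),
            s u 0 = u & s u t = x]].
  elim: t => [|t IHt] tm.
    right; exists [set x], (fun=> true), (fun u _ => u), (fun _ _ => set0); split.
    - by rewrite sub1set.
    - by rewrite cards1.
    - move=> u /set1P->; split=> //; split=> // k; rewrite leqn0 => /eqP->.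
      by rewrite fx.
  have [|[S [c [s [P [SH cS chS]]]]]] := IHt (ltnW tm); first by left.
  have [|[S' [c' [s' [P' [S'H cS' chS']]]]]] :=
    @next_level V H r m t _ _ f S c s P x r2 linH uniH tm erefl degH SH chS; first by left.
  right; exists S', c', s', P'; split=> //.
  rewrite -(leq_pmul2l K0) expnS mulnA; apply: leq_trans cS'.
  by rewrite leq_mul2l cS orbT.
have [//|[S [_ [_ [_ [_ cS _]]]]]] := levels m (leqnn m).
by have := leq_trans Va (leq_trans cS (max_card _)); rewrite ltnn.
Qed.

Lemma dense_contains_cycle (V : finType) (H : {set {set V}}) (r m a : nat) :
  2 < r -> 0 < m -> linear_hgraph H -> runiform r H -> #|V| < a ^ m ->
  2 * (3 * m.+1) ^ r.-1 * (expansion_const r m + 2 * m) * a * #|V| < #|H| ->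
  contains_copy (linear_cycle r (2 * m + 1)) H.
Proof.
move=> r2 m0 linH uniH Va ltH.
have a0 : 0 < a by move: Va; case: (a) => //; rewrite exp0n.
have [H' [sH' H'0 degH']] 
  := min_degree_subgraph (X := [set: V]) (leq_ltn_trans (leq_mul (leqnn _) (max_card _)) ltH).
have linH' := sub_linear sH' linH; have uniH' := sub_runiform sH' uniH.
(* The exponent [2 * m * a] suffices because [a ^ m <= 2 ^ (m * a)]. Being linear in [a], it fits
   with the degree [expansion_const r m * a] in one bound proportional to [a]. *)
have VM : #|V| * m.+1 < 2 ^ (2 * m * a).
  rewrite -mulnA mul2n -addnn expnD.
  apply: leq_trans (_ : a ^ m * m.+1 <= _); first by rewrite ltn_pmul2r.
  apply: leq_mul.
    by rewrite mulnC expnM leq_exp2r // ltnW // ltn_expl.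
  by apply: leq_trans (ltn_expl m (ltnSn 1)) _; rewrite leq_exp2l // leq_pmulr.
have [e v eH' ve|f fP] := exists_zoning (D := expansion_const r m * a) r2 linH' uniH' VM.
  rewrite -mulnDl mulnA; apply: ltnW; apply: degH' eH' ve _; exact: in_setT.
have : contains_copy (linear_cycle r (2 * m + 1)) H'.
  apply: (zoned_cycle (f := f) r2 linH' uniH' H'0 Va a0) => v i /bigcupP[e eH' ve].
  exact: fP eH' ve.
case/existsP => C /andP[CH' Cc]; apply/existsP; exists C.
by rewrite (subset_trans CH' sH').
Qed.

(** * The bound over the reals *)

Unset Implicit Arguments.
Import Order.TTheory GRing.Theory Num.Theory.
Local Open Scope ring_scope.

Theorem theorem6p2 (R : realType) (m r : nat)
    (hm : (2 <= m)%N) (hr : (3 <= r)%N) :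
  exists (c : R) (n2 : nat),
    [/\ 0 < c, (0 < n2)%N
      & forall n : nat, (n2 <= n)%N ->
          (exL r n (linear_cycle r (2 * m + 1)))%:R
            <= c * powR n%:R (1 + m%:R^-1)].
Proof.
have m0 : (0 < m)%N by apply: leq_trans hm.
pose C := (2 * (3 * m.+1) ^ r.-1 * (expansion_const r m + 2 * m))%N.
have C0 : (0 < C)%N by rewrite /C !muln_gt0 expn_gt0.
exists (2 * C%:R), 1%N; split=> // [|n n0]; first by rewrite mulr_gt0 ?ltr0n.
pose y : R := powR n%:R m%:R^-1.
have y1 : 1 <= y.
  by rewrite -(powRr0 n%:R); apply: ler_powR; rewrite ?ler1n // invr_ge0 ler0n.
have ym : y ^+ m = n%:R.
  by rewrite -powR_mulrn ?powR_ge0 // -powRrM mulVf ?powRr1 // pnatr_eq0 -lt0n.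
(* The integer [a] just exceeds [n^(1/m)], giving [n < a ^ m]; since [y >= 1], also [a <= 2 * y],
   the source of the factor 2 in the constant. *)
pose a := (Num.truncn y).+1.
have na : (n < a ^ m)%N.
  rewrite -(ltr_nat R) natrX -ym ltrXn2r ?(gtn_eqF m0) ?truncnS_gt //.
  exact: le_trans y1.
have ay : a%:R <= 2 * y :> R.
  have : (Num.truncn y)%:R <= y by rewrite truncn_le // (le_trans _ y1).
  by rewrite /a -natr1 mulr_natl mulr2n => h; apply: lerD.
have leC : (exL r n (linear_cycle r (2 * m + 1)) <= C * a * n)%N.
  apply/bigmax_leqP => H /and3P[uniH linH noC]; rewrite leqNgt.
  apply: contra noC => ltH.
  by apply: (@dense_contains_cycle _ _ _ _ a); rewrite ?card_ord.
clearbody C; apply: le_trans (_ : (C * a * n)%:R <= _); first by rewrite ler_nat.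
rewrite powRD; last by rewrite pnatr_eq0 -lt0n n0 implybT.
rewrite powRr1 ?ler0n // -/y 2!natrM.
have -> : 2 * C%:R * (n%:R * y) = C%:R * (2 * y) * n%:R :> R.
  by rewrite [2 * C%:R]mulrC -!mulrA [n%:R * y]mulrC.
by rewrite ler_wpM2r // ler_wpM2l.
Qed.
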